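(* Let $K$ be a field, $S=K[x_1,\dots,x_n]$, and let $I\subseteq S$ be a PLP-polymatroidal ideal of type $(\mathbf 0,\mathbf b|\boldsymbol\alpha,\boldsymbol\beta)$, with minimal set of monomial generators $G(I)$. For $\mathbf x^{\mathbf u}=x_1^{u_1}\cdots x_n^{u_n}\in G(I)$ set $$N(\mathbf u)=|\{1\le i\le n-1:\ u_i<b_i,\ u_1+\cdots+u_i<\beta_i\}|.$$ Then $$\operatorname{depth} S/I=n-1-\max\{N(\mathbf u):\ \mathbf x^{\mathbf u}\in G(I)\}.$$
   Context: $\mathbb Z_+$ denotes the non-negative integers, with $\mathbb Z_+^n$ ordered componentwise. PLP-polymatroidal ideal: let $n,d$ be positive integers and $\mathbf a,\mathbf b,\boldsymbol\alpha,\boldsymbol\beta\in\mathbb Z_+^n$ with $\mathbf a\le\mathbf b$, $\boldsymbol\alpha\le\boldsymbol\beta$, $\alpha_1\le\cdots\le\alpha_n=d$, $\beta_1\le\cdots\le\beta_n=d$. Let $B$ be the set of all $\mathbf u\in\mathbb Z_+^n$ with $a_i\le u_i\le b_i$ and $\alpha_i\le u_1+\cdots+u_i\le\beta_i$ for $i=1,\dots,n$, assumed nonempty. The PLP-polymatroidal ideal of type $(\mathbf a,\mathbf b|\boldsymbol\alpha,\boldsymbol\beta)$ is the monomial ideal of $S$ generated by $\{\mathbf x^{\mathbf u}:\mathbf u\in B\}$; since all these monomials have degree $d$, $G(I)=\{\mathbf x^{\mathbf u}:\mathbf u\in B\}$. *)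

(* Defs.v *)
From HB Require Import structures.
From mathcomp Require Import all_boot all_order all_algebra.
From mathcomp Require Export mpoly.

Set Implicit Arguments.
Unset Strict Implicit.
Unset Printing Implicit Defensive.

Import GRing.Theory.
Local Open Scope ring_scope.

Definition is_max (P : nat -> Prop) (m : nat) : Prop :=
  P m /\ forall k : nat, P k -> (k <= m)%N.

Section Depth.
Variables (K : fieldType) (n : nat).
Implicit Types (I G : {mpoly K[n]} -> Prop) (f g : {mpoly K[n]}).

Definition ideal_gen G f : Prop :=
  exists s : seq ({mpoly K[n]} * {mpoly K[n]}),
    (forall p, p \in s -> G p.2) /\ f = \sum_(p <- s) p.1 * p.2.

Definition irrelevant_ideal : {mpoly K[n]} -> Prop :=
  ideal_gen (fun g => exists i : 'I_n, g = 'X_i).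

Definition adjoin I (s : seq {mpoly K[n]}) : {mpoly K[n]} -> Prop :=
  ideal_gen (fun g => I g \/ g \in s).

(* Regular sequences on the module S/I, written with representatives in S:
   the k-th entry is a nonzerodivisor on S/(I + (s_0, ..., s_(k-1))), and
   (S/I)/(s)(S/I) is nonzero. *)
Definition regular_seq I (s : seq {mpoly K[n]}) : Prop :=
  (forall (k : nat) g, (k < size s)%N ->
     adjoin I (take k s) (s`_k * g) -> adjoin I (take k s) g)
  /\ ~ adjoin I s 1.

(* depth S/I = r, the depth being taken with respect to (x_1, ..., x_n) *)
Definition depth_quotient I (r : nat) : Prop :=
  is_max (fun k => exists s : seq {mpoly K[n]},
    [/\ size s = k, forall f, f \in s -> irrelevant_ideal f
      & regular_seq I s]) r.

(* G(I), for a monomial ideal I, as a set of exponent vectors *)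
Definition min_mon_gen I (u : 'X_{1..n}) : Prop :=
  I 'X_[u] /\ forall v : 'X_{1..n}, I 'X_[v] -> (v <= u)%MM -> v = u.

End Depth.

Section PLP.
Variables (n : nat).
Implicit Types (a b alpha beta u : 'X_{1..n}).

Definition psum u (i : 'I_n) : nat := (\sum_(j < n | j <= i) u j)%N.

Definition plp_base a b alpha beta u : Prop :=
  forall i : 'I_n,
    (a i <= u i <= b i)%N /\ (alpha i <= psum u i <= beta i)%N.

(* Indices are 0-based: the last coordinate is the i with i.+1 = n. *)
Record plp_type (d : nat) a b alpha beta : Prop := PlpType {
  plp_n_gt0 : (0 < n)%N;
  plp_d_gt0 : (0 < d)%N;
  plp_le_ab : (a <= b)%MM;
  plp_le_alpha_beta : (alpha <= beta)%MM;
  plp_alpha_homo : forall i j : 'I_n, (i <= j)%N -> (alpha i <= alpha j)%N;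
  plp_beta_homo : forall i j : 'I_n, (i <= j)%N -> (beta i <= beta j)%N;
  plp_alpha_last : forall i : 'I_n, i.+1 = n -> alpha i = d;
  plp_beta_last : forall i : 'I_n, i.+1 = n -> beta i = d;
  plp_base_nonempty : exists u, plp_base a b alpha beta u }.

Definition plp_ideal (K : fieldType) a b alpha beta : {mpoly K[n]} -> Prop :=
  ideal_gen (fun g => exists2 u, plp_base a b alpha beta u & g = 'X_[u]).

Definition plp_N b beta u : nat :=
  #|[set i : 'I_n | [&& (i.+1 < n)%N, (u i < b i)%N & (psum u i < beta i)%N]]|.

End PLP.

(* Main.v *)
Require Import Defs.
From mathcomp Require Import all_boot all_order all_algebra.
From mathcomp Require Import ring zify.
From Stdlib Require Import Classical.

Set Implicit Arguments.
Unset Strict Implicit.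
Unset Printing Implicit Defensive.

Import GRing.Theory.

(* Write B for the set of exponent vectors of G(I), F(u) for the set counted by
   N(u), and M for the maximum of N.

   depth <= n - 1 - M.  For u in B and i in F(u) let j(i) be the least j > i
   with u_j > 0.  Since the lower bound on u is 0, every nonzero term of
     x^u /\_(i in F(u)) (e_i - (x_i / x_(j(i))) e_(j(i)))
   has its coefficient in G(I), so this is a Koszul cycle z over I; its
   coefficients have degree d, hence it is not a boundary over I, and
   H_(N(u)+1)(x; S/I) <> 0.  Dividing by a regular element of (x_1, ..., x_n)
   raises the top nonvanishing degree of Koszul homology by at least one, and
   this degree never exceeds n.

   depth >= n - 1 - M.  For r <= n - #|F| the elementary symmetric polynomials
   e_1, ..., e_r are regular on S/(x_i : i in F).  By the exchange property of
   B, the sequences 0 -> S/(J : x_i) -> S/J -> S/(J, x_i) -> 0, applied to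
   i = 1, ..., n in turn, filter S/I with factors S/(x_i : i in F) where
   #|F| <= M + 1; hence e_1, ..., e_(n-1-M) is regular on S/I. *)

(** * Regular sequences modulo an ideal *)

Section WeaklyRegular.
Local Open Scope ring_scope.
Variable R : comNzRingType.
Implicit Types (J : R -> Prop) (a f g x : R) (s : seq R).

Definition is_ideal J : Prop :=
  [/\ J 0, forall f g, J f -> J g -> J (f + g) & forall f g, J g -> J (f * g)].

Definition ideal_add J a : R -> Prop := fun f => exists g, J (f - g * a).

Definition ideal_adds J s : R -> Prop := foldl ideal_add J s.

Definition ideal_colon J a : R -> Prop := fun f => J (f * a).

Definition nzd_mod J a : Prop := forall g, J (a * g) -> J g.

(* Regularity on [R/J] without the condition [R <> J + (s)]. *)
Fixpoint weakly_regular J s : Prop :=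
  if s is a :: s' then nzd_mod J a /\ weakly_regular (ideal_add J a) s'
  else True.

Lemma ideal0 J : is_ideal J -> J 0. Proof. by case. Qed.

Lemma idealD J f g : is_ideal J -> J f -> J g -> J (f + g).
Proof. by case=> _ + _; apply. Qed.

Lemma idealM J f g : is_ideal J -> J g -> J (f * g).
Proof. by case=> _ _; apply. Qed.

Lemma idealB J f g : is_ideal J -> J f -> J g -> J (f - g).
Proof. by move=> hJ hf hg; apply: idealD => //; rewrite -mulN1r; apply: idealM. Qed.

Lemma ideal_sum J (T : Type) (r : seq T) (P : pred T) (F : T -> R) :
  is_ideal J -> (forall i, P i -> J (F i)) -> J (\sum_(i <- r | P i) F i).
Proof.
by move=> hJ hF; apply: big_ind => //; [exact: ideal0|move=> ? ?; exact: idealD].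
Qed.

Lemma is_ideal_add J a : is_ideal J -> is_ideal (ideal_add J a).
Proof.
move=> hJ; split.
- by exists 0; rewrite mul0r subrr; apply: ideal0.
- move=> f g [f' hf] [g' hg]; exists (f' + g').
  have -> : f + g - (f' + g') * a = (f - f' * a) + (g - g' * a) by ring.
  exact: idealD.
- move=> f g [g' hg]; exists (f * g').
  have -> : f * g - f * g' * a = f * (g - g' * a) by ring.
  exact: idealM.
Qed.

Lemma is_ideal_adds J s : is_ideal J -> is_ideal (ideal_adds J s).
Proof. by elim: s J => //= a s IH J hJ; apply: IH; apply: is_ideal_add. Qed.

Lemma ideal_add_sub J a f : J f -> ideal_add J a f.
Proof. by exists 0; rewrite mul0r subr0. Qed.

Lemma ideal_add_mul J a f : is_ideal J -> ideal_add J a (f * a).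
Proof. by move=> hJ; exists f; rewrite subrr; apply: ideal0. Qed.

Lemma ideal_adds_sub J s f : J f -> ideal_adds J s f.
Proof. by elim: s J => //= a s IH J hf; apply/IH/ideal_add_sub. Qed.

Lemma ideal_adds_mem J s a : is_ideal J -> a \in s -> ideal_adds J s a.
Proof.
elim: s J => //= b s IH J hJ; rewrite inE => /orP[/eqP->|]; last first.
  by apply: IH; apply: is_ideal_add.
by apply: ideal_adds_sub; exists 1; rewrite mul1r subrr; apply: ideal0.
Qed.

Lemma eq_ideal_add J J' a :
  (forall f, J f <-> J' f) -> forall f, ideal_add J a f <-> ideal_add J' a f.
Proof. by move=> e f; split=> -[g hg]; exists g; apply/e. Qed.

Lemma eq_ideal_adds J J' s :
  (forall f, J f <-> J' f) -> forall f, ideal_adds J s f <-> ideal_adds J' s f.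
Proof. by elim: s J J' => //= a s IH J J' e; apply: IH; apply: eq_ideal_add. Qed.

Lemma eq_weakly_regular J J' s :
  (forall f, J f <-> J' f) -> weakly_regular J s -> weakly_regular J' s.
Proof.
elim: s J J' => //= a s IH J J' e [ha hs]; split.
  by move=> g /e /ha /e.
by apply: IH hs; apply: eq_ideal_add.
Qed.

Lemma ideal_addC J a c f :
  ideal_add (ideal_add J a) c f <-> ideal_add (ideal_add J c) a f.
Proof.
by split=> -[g [h hh]]; exists h, g; rewrite addrAC.
Qed.

Lemma ideal_adds_add J s a f :
  ideal_adds (ideal_add J a) s f <-> ideal_add (ideal_adds J s) a f.
Proof.
elim: s J f => //= c s IH J f.
rewrite -IH; apply: eq_ideal_adds => {}f; exact: ideal_addC.
Qed.

Lemma weakly_regular_rcons J s a :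
  weakly_regular J (rcons s a) <-> weakly_regular J s /\ nzd_mod (ideal_adds J s) a.
Proof. by elim: s J => /= [|c s IH] J; [tauto|rewrite IH; tauto]. Qed.

(* The exact sequence is [0 -> R/(J : x) -> R/J -> R/(J, x) -> 0]. *)
Lemma weakly_regular_colon J x s : is_ideal J ->
  weakly_regular (ideal_colon J x) s -> weakly_regular (ideal_add J x) s ->
  weakly_regular J s.
Proof.
elim: s J => //= a s IH J hJ [ha hs] [ha' hs']; split.
  move=> g hg; have [h hh] : ideal_add J x g by apply/ha'/ideal_add_sub.
  have : ideal_colon J x (a * h).
    rewrite /ideal_colon; have -> : a * h * x = a * g - a * (g - h * x) by ring.
    by apply: idealB => //; apply: idealM.
  move=> /ha hx; have -> : g = (g - h * x) + h * x by ring.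
  exact: idealD.
apply: IH; first exact: is_ideal_add.
  apply: eq_weakly_regular hs => f; split=> -[g hg].
    exists (g * x); rewrite /ideal_colon in hg.
    by have <- : (f - g * a) * x = f * x - g * x * a by ring.
  have [h hh] : ideal_add J x g.
    apply: ha'; exists f.
    have -> : a * g - f * x = - 1 * (f * x - g * a) by ring.
    exact: idealM.
  exists h; rewrite /ideal_colon.
  have -> : (f - h * a) * x = (f * x - g * a) + a * (g - h * x) by ring.
  by apply: idealD => //; apply: idealM.
by apply: eq_weakly_regular hs' => f; apply: ideal_addC.
Qed.

(** Induction on [s]: if [x g = h a] modulo [J], regularity of [a] modulo [J + (x)] gives [h = k x]
    modulo [J], and cancelling [x] gives [g = k a]. So [x] stays regular modulo [J + (a)]. *)
Lemma nzd_mod_adds J x s : is_ideal J -> nzd_mod J x ->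
  weakly_regular J s -> weakly_regular (ideal_add J x) s ->
  nzd_mod (ideal_adds J s) x.
Proof.
elim: s J => //= a s IH J hJ hx [ha hs] [ha' hs'].
apply: IH => //; first exact: is_ideal_add.
  move=> g [h hh].
  have [k hk] : ideal_add J x h.
    apply: ha'; exists g.
    have -> : a * h - g * x = - 1 * (x * g - h * a) by ring.
    exact: idealM.
  exists k; apply: hx.
  have -> : x * (g - k * a) = (x * g - h * a) + a * (h - k * x) by ring.
  by apply: idealD => //; apply: idealM.
by apply: eq_weakly_regular hs' => f; apply: ideal_addC.
Qed.

Lemma nzd_mod_prod J (T : Type) (r : seq T) (P : pred T) (F : T -> R) :
  (forall i, P i -> nzd_mod J (F i)) -> nzd_mod J (\prod_(i <- r | P i) F i).
Proof.
move=> hF; apply: big_ind => //.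
  by move=> g; rewrite mul1r.
by move=> a c ha hc g; rewrite -mulrA => /ha /hc.
Qed.

End WeaklyRegular.

(** * Monomial ideals and elementary symmetric polynomials *)

Section MonomialIdeals.
Local Open Scope ring_scope.
Variables (K : fieldType) (n : nat).
Local Notation S := {mpoly K[n]}.
Implicit Types (U : 'X_{1..n} -> Prop) (G J : S -> Prop) (f g a : S).
Implicit Types (s : seq S) (m : 'X_{1..n}) (F : {set 'I_n}) (i j : 'I_n).

Lemma is_ideal_gen G : is_ideal (ideal_gen G).
Proof.
split; first by exists [::]; rewrite big_nil.
  move=> _ _ [s [hs ->]] [t [ht ->]]; exists (s ++ t); rewrite big_cat; split=> //.
  by move=> p; rewrite mem_cat => /orP[/hs|/ht].
move=> f _ [s [hs ->]]; exists [seq (f * p.1, p.2) | p <- s]; split.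
  by move=> _ /mapP[p /hs hp ->].
by rewrite big_map mulr_sumr; apply: eq_bigr => p _; rewrite mulrA.
Qed.

Lemma mem_ideal_gen G f : G f -> ideal_gen G f.
Proof.
move=> hf; exists [:: (1, f)]; rewrite big_seq1 mul1r; split=> // p.
by rewrite inE => /eqP->.
Qed.

Lemma ideal_gen_min G J f :
  is_ideal J -> (forall g, G g -> J g) -> ideal_gen G f -> J f.
Proof.
move=> hJ hG [s [hs ->]]; rewrite big_seq; apply: ideal_sum => // p hp.
by apply: idealM => //; apply/hG/hs.
Qed.

Lemma ideal_adds_min J J' s f : is_ideal J' -> (forall g, J g -> J' g) ->
  (forall g, g \in s -> J' g) -> ideal_adds J s f -> J' f.
Proof.
elim: s J => [J _ + _|a s IH J hJ' hs hm] /=; first exact.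
apply: IH => // [g [h hg]|g hg]; last by apply: hm; rewrite inE hg orbT.
rewrite -(subrK (h * a) g); apply: idealD => //; first exact: hs.
by apply: idealM => //; apply: hm; rewrite inE eqxx.
Qed.

Lemma adjoinE J s f : is_ideal J -> adjoin J s f <-> ideal_adds J s f.
Proof.
move=> hJ; split.
  apply: ideal_gen_min; first exact: is_ideal_adds.
  by move=> g [|]; [exact: ideal_adds_sub|exact: ideal_adds_mem].
by apply: ideal_adds_min => [|g hg|g hg]; [exact: is_ideal_gen|..];
  apply: mem_ideal_gen; [left|right].
Qed.

Lemma weakly_regularP J s : weakly_regular J s <->
  forall k, (k < size s)%N -> nzd_mod (ideal_adds J (take k s)) s`_k.
Proof.
elim: s J => [|a s IH] J //=; rewrite IH; split.
  by case=> ha hs [|k] hk; [exact: ha|exact: hs].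
by move=> h; split=> [|k hk]; [exact: (h 0%N)|exact: (h k.+1)].
Qed.

Lemma regular_seqE J s : is_ideal J ->
  regular_seq J s <-> weakly_regular J s /\ ~ ideal_adds J s 1.
Proof.
move=> hJ; rewrite /regular_seq weakly_regularP.
split=> -[h1 h2]; split; [|by rewrite -adjoinE| |by rewrite adjoinE].
  by move=> k hk g; rewrite -!adjoinE //; apply: h1.
by move=> k g hk; rewrite !adjoinE //; apply: h1.
Qed.

(** The span of the monomials with exponent in [U], an ideal when [U] is [up_closed]. Colons by a
    variable and sums with a variable become operations on [U]. *)
Definition mon_ideal U : S -> Prop := fun f => forall m, m \in msupp f -> U m.

Definition up_closed U : Prop := forall m i, U m -> U (m + U_(i))%MM.

Lemma up_closed_le U m m' : up_closed U -> U m -> (m <= m')%MM -> U m'.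
Proof.
move=> hU hm le; rewrite -(submK le) addmC; move: (m' - m)%MM => d {m' le}.
have [k] := ubnP (mdeg d); elim: k d => // k IH d hd.
case: (eqVneq d 0%MM) => [->|]; first by rewrite addm0.
rewrite -mdeg_eq0 mdegE sum_nat_eq0 => /forallPn[i /= hi].
have le : (U_(i) <= d)%MM by rewrite lep1mP.
rewrite -(submK le) addmA; apply/hU/IH; move: hd.
by rewrite -{1}(submK le) mdegD mdeg1 addn1.
Qed.

Lemma is_ideal_mon U : up_closed U -> is_ideal (mon_ideal U).
Proof.
move=> hU; split; first by move=> m; rewrite msupp0.
  by move=> f g hf hg m /msuppD_le; rewrite mem_cat => /orP[/hf|/hg].
move=> f g hg m /msuppM_le /allpairsP[[m1 m2] /= [_ h2 ->]].
by apply: up_closed_le (hg _ h2) _ => //; apply: lem_addl.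
Qed.

Lemma eq_mon_ideal (U U' : 'X_{1..n} -> Prop) : (forall v, U v <-> U' v) ->
  forall f : S, mon_ideal U f <-> mon_ideal U' f.
Proof. by move=> e f; split=> h v /h /e. Qed.

Lemma weakly_regular_mon_full (U : 'X_{1..n} -> Prop) (s : seq S) :
  (forall v, U v) -> weakly_regular (mon_ideal U) s.
Proof.
move=> hU; have: forall f : S, mon_ideal U f by move=> f v _.
elim: s (mon_ideal U) => //= a s IH J hJ; split=> //.
by apply: IH => f; exists 0; apply: hJ.
Qed.

Lemma mon_idealX U m : U m -> mon_ideal U 'X_[m].
Proof. by move=> hm m' /mem_msuppXP <-. Qed.

Lemma mon_ideal_colon U i f :
  ideal_colon (mon_ideal U) 'X_i f <-> mon_ideal (fun m => U (m + U_(i))%MM) f.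
Proof.
rewrite /ideal_colon /mon_ideal; split=> h m.
  by move=> hm; apply: h; rewrite (perm_mem (msuppMX _ _)) addmC map_f.
by rewrite (perm_mem (msuppMX _ _)) => /mapP[m' /h + ->]; rewrite addmC.
Qed.

Lemma mon_ideal_add U i f : up_closed U ->
  ideal_add (mon_ideal U) 'X_i f <-> mon_ideal (fun m => U m \/ (0 < m i)%N) f.
Proof.
move=> hU; split.
  move=> [g hg]; rewrite -(subrK (g * 'X_i) f).
  move=> m /msuppD_le; rewrite mem_cat => /orP[/hg|]; first by left.
  rewrite (perm_mem (msuppMX _ _)) => /mapP[m' _ ->]; right.
  by rewrite mnmDE mnm1E eqxx.
move=> h; have hI := is_ideal_add 'X_i (is_ideal_mon hU).
rewrite [f]mpolyE big_seq; apply: ideal_sum => // m /h hm.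
rewrite -mul_mpolyC; apply: idealM => //; case: hm => hm.
  by apply: ideal_add_sub; apply: mon_idealX.
have le : (U_(i) <= m)%MM by rewrite lep1mP -lt0n.
by rewrite -(submK le) mpolyXD; apply: ideal_add_mul; apply: is_ideal_mon.
Qed.

Lemma up_closed_gen (B : 'X_{1..n} -> Prop) :
  up_closed (fun m => exists2 u, B u & (u <= m)%MM).
Proof. by move=> m i [u hu le]; exists u => //; apply: lepm_trans le (lem_addr _ _). Qed.

Lemma mon_ideal_gen (B : 'X_{1..n} -> Prop) f :
  ideal_gen (fun g => exists2 u, B u & g = 'X_[u]) f <->
  mon_ideal (fun m => exists2 u, B u & (u <= m)%MM) f.
Proof.
split.
  apply: ideal_gen_min; first exact/is_ideal_mon/up_closed_gen.
  by move=> _ [u hu ->]; apply: mon_idealX; exists u => //; apply: lepm_refl.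
move=> h; rewrite [f]mpolyE big_seq; apply: ideal_sum (is_ideal_gen _) _.
move=> m /h [u hu le]; rewrite -mul_mpolyC -(submK le) mpolyXD mulrA.
by apply: idealM; [exact: is_ideal_gen|apply: mem_ideal_gen; exists u].
Qed.

Lemma irrelevantP f : irrelevant_ideal f <->
  exists g : 'I_n -> S, f = \sum_i g i * 'X_i.
Proof.
split; last first.
  move=> [g ->]; apply: ideal_sum; first exact: is_ideal_gen.
  by move=> i _; apply: idealM; [exact: is_ideal_gen|apply: mem_ideal_gen; exists i].
apply: (ideal_gen_min (J := fun f => exists g : 'I_n -> S, f = \sum_i g i * 'X_i)); last first.
  move=> _ [i ->]; exists (fun j => (j == i)%:R); rewrite (bigD1 i) //= eqxx mul1r big1 ?addr0 //.
  by move=> j /negbTE->; rewrite mul0r.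
split; first by exists (fun=> 0); rewrite big1 // => i _; rewrite mul0r.
  move=> _ _ [g ->] [h ->]; exists (fun i => g i + h i).
  by rewrite -big_split; apply: eq_bigr => i _; rewrite mulrDl.
move=> f' _ [g ->]; exists (fun i => f' * g i).
by rewrite mulr_sumr; apply: eq_bigr => i _; rewrite mulrA.
Qed.

Lemma irrelevant_mon f : irrelevant_ideal f <-> mon_ideal (fun m => m != 0%MM) f.
Proof.
split.
  apply: ideal_gen_min; last by move=> _ [i ->]; apply: mon_idealX; rewrite mnm1_eq0.
  by apply: is_ideal_mon => m i; rewrite !mnmD_eq0 mnm1_eq0 andbF.
move=> h; rewrite [f]mpolyE big_seq; apply: ideal_sum (is_ideal_gen _) _.
move=> m /h; rewrite -mdeg_eq0 mdegE sum_nat_eq0 => /forallPn[i /= hi].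
have le : (U_(i) <= m)%MM by rewrite lep1mP.
rewrite -mul_mpolyC -(submK le) mpolyXD mulrA.
by apply: idealM; [exact: is_ideal_gen|apply: mem_ideal_gen; exists i].
Qed.

(** * Homogeneous ideals and homogeneous components *)

Definition homog_ideal J : Prop := forall d f, J f -> J (pihomog mdeg d f).

Lemma homog_mon_ideal U : homog_ideal (mon_ideal U).
Proof.
move=> d f h m; rewrite mcoeff_msupp pihomogE raddf_sum /= => hm.
apply: h; rewrite mcoeff_msupp; apply: contra hm => /eqP hm.
rewrite big1 // => m' _; rewrite mcoeffZ mcoeffX.
by case: eqP => [->|]; rewrite ?mulr0 // hm mul0r.
Qed.

Lemma pihomogMr d k a g : a \is k.-homog ->
  pihomog mdeg d (g * a) = (if (k <= d)%N then pihomog mdeg (d - k) g else 0) * a.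
Proof.
(* [N] exceeds every degree in [g] and also [d], so the index [d - k] occurs in the decomposition of
   [g]. *)
move=> ha; set N := maxn (msize g) d.+1.
have hN : (msize g <= N)%N by rewrite leq_maxl.
rewrite {1}(pihomog_partitionE hN) mulr_suml linear_sum /=.
have E (j : 'I_N) : pihomog mdeg d (pihomog mdeg j g * a) =
    if (j + k == d)%N then pihomog mdeg j g * a else 0.
  have hja := dhomogM (pihomogP mdeg j g) ha.
  by case: eqP => [<-|/eqP ne]; [exact: pihomog_dE|exact: pihomog_ne0 ne hja].
etransitivity; first by apply: eq_bigr => j _; apply: E.
case: leqP => hk.
  have hd : (d - k < N)%N by rewrite leq_max ltnS leq_subr orbT.
  rewrite (bigD1 (Ordinal hd)) //= subnK // eqxx big1 ?addr0 // => j.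
  rewrite -val_eqE /= => ne; case: eqP => // e; move: ne.
  by rewrite -e addnK eqxx.
rewrite mul0r big1 // => j _; case: eqP => // e; move: hk.
by rewrite -e ltnNge leq_addl.
Qed.

Lemma homog_ideal_add J a k :
  homog_ideal J -> a \is k.-homog -> homog_ideal (ideal_add J a).
Proof.
move=> hJ ha d f [g hg]; exists (if (k <= d)%N then pihomog mdeg (d - k) g else 0).
by rewrite -pihomogMr // -linearB; apply: hJ.
Qed.

Lemma homog_ideal_adds J s : homog_ideal J ->
  (forall a, a \in s -> exists k, a \is k.-homog) -> homog_ideal (ideal_adds J s).
Proof.
elim: s J => //= a s IH J hJ hs; apply: IH.
  by have [k hk] := hs a (mem_head _ _); apply: homog_ideal_add hk.
by move=> c hc; apply: hs; rewrite inE hc orbT.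
Qed.

(* A graded instance of Krull's intersection theorem: iterating the hypothesis,
   [g] lies in [J + (x_i^k)] for all [k], in particular for [k] above its degree. *)
Lemma homog_ideal_descent J (P : S -> Prop) i g : is_ideal J -> homog_ideal J ->
  (forall h, P h -> exists2 h', P h' & J (h - h' * 'X_i)) -> P g -> J g.
Proof.
move=> hJ hh hP hg.
have [h hk] : exists h, J (g - h * 'X_i ^+ msize g).
  suff: exists2 h, P h & J (g - h * 'X_i ^+ msize g) by case=> h; exists h.
  elim: (msize g) => [|k [h hPh hk]].
    by exists g => //; rewrite expr0 mulr1 subrr; apply: ideal0.
  have [h' hPh' hh'] := hP h hPh; exists h' => //.
  have -> : g - h' * 'X_i ^+ k.+1 =
    (g - h * 'X_i ^+ k) + 'X_i ^+ k * (h - h' * 'X_i) by rewrite exprS; ring.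
  by apply: idealD => //; apply: idealM.
rewrite [g](pihomog_partitionE (leqnn (msize g))); apply: ideal_sum => // d _.
move: (hh d _ hk); rewrite raddfB /= (@pihomogMr d (msize g)).
  by rewrite leqNgt ltn_ord mul0r subr0.
have hX : ('X_i : S) \is 1.-homog by rewrite dhomogX; apply/eqP; apply: mdeg1.
by have := dhomogMn (msize g) hX; rewrite mul1n.
Qed.

(** * Ideals generated by variables, and elementary symmetric polynomials modulo them *)

Definition coord_ideal F : S -> Prop :=
  mon_ideal (fun m => exists2 i, i \in F & (0 < m i)%N).

Lemma up_closed_coord F : up_closed (fun m => exists2 i, i \in F & (0 < m i)%N).
Proof. by move=> m j [i hi hm]; exists i; rewrite // mnmDE ltn_addr. Qed.

Lemma is_ideal_coord F : is_ideal (coord_ideal F).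
Proof. exact/is_ideal_mon/up_closed_coord. Qed.

Lemma coord_ideal_add F j f :
  ideal_add (coord_ideal F) 'X_j f <-> coord_ideal (j |: F) f.
Proof.
rewrite mon_ideal_add; last exact: up_closed_coord.
split=> h m /h.
  case=> [[i hi hm]|hm]; first by exists i; rewrite // inE hi orbT.
  by exists j; rewrite // !inE eqxx.
by case=> i /setU1P[->|hi] hm; [right|left; exists i].
Qed.

Lemma nzd_mod_coordX F j : j \notin F -> nzd_mod (coord_ideal F) 'X_j.
Proof.
move=> hj g h m hm; have : (m + U_(j))%MM \in msupp ('X_j * g).
  by rewrite mulrC (perm_mem (msuppMX _ _)) addmC map_f.
case/h => i hi; rewrite mnmDE mnm1E; case: eqP => [e|_]; last by rewrite addn0; exists i.
by move: hj; rewrite e hi.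
Qed.

Definition esym_seq r : seq S := [seq mesym n K k.+1 | k <- iota 0 r].

Lemma esym_seqS r : esym_seq r.+1 = rcons (esym_seq r) (mesym n K r.+1).
Proof. by rewrite /esym_seq -addn1 iotaD map_cat cats1 addn1. Qed.

Lemma esym_seq_homog r a : a \in esym_seq r -> exists k, a \is k.-homog.
Proof. by case/mapP => i _ ->; exists i.+1; apply: dhomog_mesym. Qed.

Lemma esym_seq_irrelevant r a : a \in esym_seq r -> irrelevant_ideal a.
Proof.
case/mapP => i _ ->; apply/irrelevant_mon => m.
have /dhomogP hh := dhomog_mesym n K i.+1; move/hh => /= h.
by apply/eqP => m0; move: h; rewrite m0 mdeg0.
Qed.

(* Modulo the variables in [F], the only surviving term of [e_#|~: F|] is the
   product of the others. *)
Lemma nzd_mod_mesym_top F s : weakly_regular (coord_ideal F) s ->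
  (forall j, j \notin F -> weakly_regular (coord_ideal (j |: F)) s) ->
  nzd_mod (ideal_adds (coord_ideal F) s) (mesym n K #|~: F|).
Proof.
move=> hF hjF g hg; have hI := is_ideal_adds s (is_ideal_coord F).
have hp : nzd_mod (ideal_adds (coord_ideal F) s) (\prod_(j in ~: F) 'X_j).
  apply: nzd_mod_prod => j; rewrite inE => hj.
  apply: nzd_mod_adds => //; [exact: is_ideal_coord|exact: nzd_mod_coordX|].
  by apply: eq_weakly_regular (hjF j hj) => f; rewrite coord_ideal_add.
apply: hp; set p := \prod_(_ in _) _.
have -> : p * g = mesym n K #|~: F| * g - g * (mesym n K #|~: F| - p) by ring.
apply: idealB => //; apply: idealM => //; apply: ideal_adds_sub.
rewrite /mesym (bigD1 (~: F)) //= -/p.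
rewrite addrAC subrr add0r.
apply: ideal_sum; first exact: is_ideal_coord.
move=> A /andP[/eqP cA neA].
have [i iA iF] : exists2 i, i \in A & i \in F.
  have: ~~ (A \subset ~: F).
    by apply: contra neA => sA; rewrite eqEcard sA cA leqnn.
  by case/subsetPn => i iA; rewrite inE negbK; exists i.
rewrite (bigD1 i) //= mulrC; apply: (idealM _ (is_ideal_coord F)).
by apply: mon_idealX; exists i; rewrite // mnm1E eqxx.
Qed.

(** Induction on [r], then on [k = #|~: F| - r.+1]. At [k = 0] the polynomial to add is the one
    treated by [nzd_mod_mesym_top]. Otherwise a variable [x_j] outside [F] is regular modulo the
    earlier polynomials, and the case of [j |: F], where [k] is smaller, is lifted back through
    [x_j]. *)
Lemma weakly_regular_esym r F :
  (r <= #|~: F|)%N -> weakly_regular (coord_ideal F) (esym_seq r).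
Proof.
elim: r F => [//|r IHr] F; rewrite esym_seqS => hr.
have card_add (G : {set 'I_n}) j : j \notin G -> #|~: G| = #|~: (j |: G)|.+1.
  move=> hj; rewrite (cardsD1 j (~: G)) inE hj add1n; congr _.+1.
  by apply: eq_card => k; rewrite !inE negb_or.
rewrite weakly_regular_rcons; split; first by apply/IHr/ltnW.
have [k hk] : {k | #|~: F| = (r.+1 + k)%N} by exists (#|~: F| - r.+1)%N; rewrite subnKC.
elim: k F hr hk => [|k IHk] F hr hk.
  rewrite -(addn0 r.+1) -hk; apply: nzd_mod_mesym_top; first by apply/IHr/ltnW.
  by move=> j hj; apply: IHr; rewrite -ltnS -card_add.
have [j hj] : exists j, j \in ~: F by apply/card_gt0P; rewrite hk.
rewrite inE in hj; have hc := card_add F j hj.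
have hkj : #|~: (j |: F)| = (r.+1 + k)%N by move: hc; rewrite hk addnS => -[].
have hrj : (r < #|~: (j |: F)|)%N by rewrite hkj ltn_addr.
set Q := ideal_adds _ _; have hQ : is_ideal Q by apply/is_ideal_adds/is_ideal_coord.
have hQj f : ideal_adds (coord_ideal (j |: F)) (esym_seq r) f <-> ideal_add Q 'X_j f.
  rewrite -ideal_adds_add; apply: eq_ideal_adds => g.
  by rewrite coord_ideal_add.
have hx : nzd_mod Q 'X_j.
  apply: nzd_mod_adds; [exact: is_ideal_coord|exact: nzd_mod_coordX| |].
    by apply/IHr/ltnW.
  apply: eq_weakly_regular (IHr (j |: F) (ltnW hrj)) => f.
  by rewrite coord_ideal_add.
(* If [e_(r+1) h] lies in [Q], the case of [j |: F] gives [h = h' x_j] modulo [Q], and cancelling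
   [x_j] puts [e_(r+1) h'] in [Q] again. *)
move=> g; apply: (@homog_ideal_descent Q (fun g => Q (mesym n K r.+1 * g)) j) => //.
  by apply: homog_ideal_adds; [exact: homog_mon_ideal|exact: esym_seq_homog].
move=> h hh; have /hQj [h' hh'] : ideal_adds (coord_ideal (j |: F)) (esym_seq r) h.
  by apply: (IHk (j |: F) hrj hkj); apply/hQj/ideal_add_sub.
exists h' => //; apply: hx.
have -> : 'X_j * (mesym n K r.+1 * h') =
  mesym n K r.+1 * h - mesym n K r.+1 * (h - h' * 'X_j) by ring.
by apply: idealB => //; apply: idealM.
Qed.

End MonomialIdeals.

(** * Koszul homology *)

Section Koszul.
Local Open Scope ring_scope.
Variables (n : nat) (R : comNzRingType).
Implicit Types (x : 'I_n -> R) (i j k : 'I_n) (A : {set 'I_n}).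
Implicit Types (c v w y z : {set 'I_n} -> R) (J : R -> Prop) (s : seq R).

(* A Koszul chain is the family of its coordinates on the wedges [e_A]. *)
Definition ksign i A : R := (-1) ^+ #|[set j in A | (j < i)%N]|.

Definition kdiff x c A : R := \sum_(i | i \notin A) ksign i A * x i * c (i |: A).

(* Left multiplication by [e_k]. *)
Definition kwedge k c A : R := if k \in A then ksign k A * c (A :\ k) else 0.

Lemma ksign2 i A : ksign i A * ksign i A = 1.
Proof. by rewrite -expr2 sqrr_sign. Qed.

Lemma ksignU1 i k A : k \notin A ->
  ksign i (k |: A) = (-1) ^+ (k < i)%N * ksign i A.
Proof.
move=> kA; rewrite -exprD; congr (_ ^+ _); case: (ltnP k i) => ki.
  rewrite -[LHS]/#|[set j in k |: A | (j < i)%N]|.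
  have -> : [set j in k |: A | (j < i)%N] = k |: [set j in A | (j < i)%N].
    by apply/setP => j; rewrite !inE; case: eqP => [->|].
  by rewrite cardsU1 inE (negbTE kA).
apply: eq_card => j; rewrite !inE; case: eqP => //= ->.
by rewrite ltnNge ki andbF.
Qed.

Lemma eq_kdiff x c c' : c =1 c' -> kdiff x c =1 kdiff x c'.
Proof. by move=> e A; apply: eq_bigr => i _; rewrite e. Qed.

Lemma kdiffB x c c' A : kdiff x (fun B => c B - c' B) A = kdiff x c A - kdiff x c' A.
Proof. by rewrite -sumrB; apply: eq_bigr => i _; rewrite mulrBr. Qed.

Lemma kdiffZ x f c A : kdiff x (fun B => f * c B) A = f * kdiff x c A.
Proof. by rewrite mulr_sumr; apply: eq_bigr => i _; ring. Qed.

Lemma kdiff_sum x (cs : 'I_n -> {set 'I_n} -> R) A :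
  kdiff x (fun B => \sum_i cs i B) A = \sum_i kdiff x (cs i) A.
Proof. by rewrite exchange_big; apply: eq_bigr => i _; rewrite mulr_sumr. Qed.

Lemma kdiff_ideal x J c : is_ideal J -> (forall A, J (c A)) ->
  forall A, J (kdiff x c A).
Proof. by move=> hJ hc A; apply: ideal_sum => // i _; apply: idealM. Qed.

Lemma kwedge_ideal k J c : is_ideal J -> (forall A, J (c A)) ->
  forall A, J (kwedge k c A).
Proof.
by move=> hJ hc A; rewrite /kwedge; case: ifP => _; [apply: idealM|apply: ideal0].
Qed.

(** Left multiplication by [e_k] is a homotopy between multiplication by [x_k] and zero. If [k] is
    outside [A], only the term [i = k] survives; if [k] is in [A], the terms with [i != k] cancel in
    pairs. *)
Lemma kdiff_wedge x k c A :
  kdiff x (kwedge k c) A + kwedge k (kdiff x c) A = x k * c A.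
Proof.
have [kA|kA] := boolP (k \in A); last first.
  rewrite {2}/kwedge (negbTE kA) addr0 /kdiff (bigD1 k) //= big1 ?addr0.
    rewrite /kwedge setU11 setU1K // ksignU1 // ltnn expr0 mul1r.
    by rewrite -[RHS]mul1r -(ksign2 k A); ring.
  move=> i /andP[iA ik]; rewrite /kwedge !inE (negbTE kA) eq_sym (negbTE ik).
  by rewrite mulr0.
have kA' : k \notin A :\ k by rewrite !inE eqxx.
rewrite {2}/kwedge kA /kdiff [X in _ + _ * X](bigD1 k) //= setD1K // mulrDr.
have -> : ksign k A * (ksign k (A :\ k) * x k * c A) = x k * c A.
  rewrite -{1}(setD1K kA) ksignU1 // ltnn expr0 mul1r.
  by rewrite -[RHS]mul1r -(ksign2 k (A :\ k)); ring.
rewrite addrCA -[RHS]addr0; congr (_ + _); rewrite mulr_sumr.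
rewrite [X in _ + X](eq_bigl (fun i => i \notin A)).
  rewrite -big_split /=; apply: big1 => i iA.
  have ik : i != k by apply: contraNneq iA => ->.
  have -> : kwedge k c (i |: A) = ksign k (i |: A) * c (i |: (A :\ k)).
    rewrite /kwedge inE kA orbT; congr (_ * c _).
    by apply/setP => j; rewrite !inE; case: (eqVneq j k) => [->|]; rewrite ?(eq_sym k) ?(negbTE ik).
  have eA : ksign i A = (-1) ^+ (k < i)%N * ksign i (A :\ k).
    by rewrite -[in LHS](setD1K kA) ksignU1.
  rewrite eA (ksignU1 k iA).
  (* Exactly one of [k < i] and [i < k] holds, so exchanging [e_k] and [e_i] costs a sign. *)
  have : (-1) ^+ (k < i)%N * (-1) ^+ (i < k)%N = -1 :> R.
    by case: (ltngtP i k) ik => //= [_ _|_ _|/val_inj->]; rewrite ?eqxx // ?expr0 expr1 ?mulr1 ?mul1r.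
  set e := (-1) ^+ (k < i)%N; set e' := (-1) ^+ (i < k)%N => he; set C := c _.
  transitivity ((e * e' + 1) * (ksign i (A :\ k) * x i * (ksign k A * C))); last first.
    by rewrite he addNr mul0r.
  by ring.
by move=> i; rewrite !inE; case: eqP => [->|_]; rewrite ?kA //= andbT.
Qed.

Lemma sum_antisym (F : 'I_n -> 'I_n -> R) : (forall i, F i i = 0) ->
  (forall i j, (i < j)%N -> F j i = - F i j) -> \sum_i \sum_j F i j = 0.
Proof.
move=> F0 FN; pose G i j := if (i < j)%N then F i j else 0.
have E i j : F i j = G i j - G j i.
  rewrite /G; case: (ltngtP i j) => [||/val_inj->]; rewrite ?subr0 ?F0 //.
  by move/FN->; rewrite sub0r.
rewrite (eq_bigr (fun i => \sum_j G i j - \sum_j G j i)).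
  by rewrite sumrB [X in _ - X]exchange_big subrr.
by move=> i _; rewrite -sumrB; apply: eq_bigr => j _.
Qed.

(** The terms that adjoin [i] and [j] to [A] in the two possible orders have opposite signs. *)
Lemma kdiff_kdiff x c A : kdiff x (kdiff x c) A = 0.
Proof.
pose T i j := ksign i A * x i * (ksign j (i |: A) * x j * c (j |: (i |: A))).
pose F i j := if [&& i \notin A, j \notin A & i != j] then T i j else 0.
transitivity (\sum_i \sum_j F i j).
  rewrite /kdiff big_mkcond; apply: eq_bigr => i _; rewrite /F.
  have [iA|iA] := boolP (i \in A); first by rewrite /= big1_eq.
  rewrite mulr_sumr big_mkcond; apply: eq_bigr => j _.
  by rewrite /= !inE negb_or eq_sym andbC.
apply: sum_antisym => [i|i j ij]; first by rewrite /F eqxx !andbF.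
rewrite /F eq_sym [j \notin A]lock andbCA -lock; case: ifP; last by rewrite oppr0.
case/and3P => iA jA _; rewrite /T !ksignU1 // setUCA ij ltnNge ltnW //= expr0 expr1.
by ring.
Qed.

Lemma kwedge_neq0 k c A :
  kwedge k c A != 0 -> k \in A /\ c (A :\ k) != 0.
Proof.
rewrite /kwedge; case: ifP => [_|]; last by rewrite eqxx.
by move=> h; split=> //; apply: contra_neq h => ->; rewrite mulr0.
Qed.

Definition chain_deg p c : Prop := forall A, c A != 0 -> #|A| = p.

Definition chain_cycle x J c : Prop := forall A, J (kdiff x c A).

Definition chain_boundary x J c : Prop :=
  exists v, forall A, J (c A - kdiff x v A).

Lemma chain_deg_wedge p k c : chain_deg p c -> chain_deg p.+1 (kwedge k c).
Proof.
move=> hc A; rewrite /kwedge; case: ifP => [kA|]; last by rewrite eqxx.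
rewrite (cardsD1 k) kA => h; congr _.+1; apply: hc.
by apply: contra_neq h => ->; rewrite mulr0.
Qed.

(* If [z] is a cycle mod [J] and [f] is in [(x)], then [f z = d w]; for [f]
   regular, [w] bounds mod [J + (f)] only if [z] bounds mod [J]. *)
Lemma koszul_lift x J f (g : 'I_n -> R) p z :
  is_ideal J -> f = \sum_i g i * x i -> nzd_mod J f ->
  chain_deg p z -> chain_cycle x J z -> ~ chain_boundary x J z ->
  exists w, [/\ chain_deg p.+1 w, chain_cycle x (ideal_add J f) w
              & ~ chain_boundary x (ideal_add J f) w].
Proof.
move=> hJ fE fJ zp zJ zB; pose w A := \sum_i g i * kwedge i z A; exists w.
have dw A : kdiff x w A = z A * f - \sum_i g i * kwedge i (kdiff x z) A.
  rewrite kdiff_sum fE mulr_sumr -sumrB; apply: eq_bigr => i _.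
  rewrite kdiffZ; have := kdiff_wedge x i z A; move/(canRL (addrK _))->.
  by ring.
have wJ A : J (kdiff x w A - z A * f).
  rewrite dw addrAC subrr add0r -sumrN; apply: ideal_sum => // i _.
  by rewrite -mulNr; apply: idealM => //; apply: kwedge_ideal.
split.
- move=> A hA; apply/eqP; apply: contraNT hA => Ap; apply/eqP/big1 => i _.
  have [->|/(chain_deg_wedge (k := i) zp) e] := eqVneq (kwedge i z A) 0.
    by rewrite mulr0.
  by rewrite e eqxx in Ap.
- by move=> A; exists (z A).
- case=> v /fin_all_exists [y hy]; apply: zB; exists y => A; apply: fJ.
  have := kdiff_ideal x hJ hy A.
  rewrite !(kdiffB, kdiff_kdiff) subr0 (eq_kdiff _ (fun B => mulrC (y B) f)) kdiffZ => h.
  have -> : f * (z A - kdiff x y A) = (kdiff x w A - f * kdiff x y A) -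
    (kdiff x w A - z A * f) by ring.
  exact: idealB.
Qed.

(** Each entry of [s] yields, through [koszul_lift], a nonbounding cycle of degree one higher. A
    chain of degree above [n] is zero and therefore bounds. *)
Lemma koszul_bound x J s p z : is_ideal J ->
  (forall f, f \in s -> exists g : 'I_n -> R, f = \sum_i g i * x i) ->
  weakly_regular J s ->
  chain_deg p z -> chain_cycle x J z -> ~ chain_boundary x J z ->
  (p + size s <= n)%N.
Proof.
elim: s J p z => [|f s IH] J p z hJ hs /=.
  move=> _ zp _ zB; rewrite addn0; apply: NNPP => hpn; apply: zB; exists (fun=> 0) => A.
  rewrite /kdiff big1 ?subr0; last by move=> i _; rewrite mulr0.
  have [->|/zp e] := eqVneq (z A) 0; first exact: ideal0.
  by case: hpn; rewrite -e -[n in (_ <= n)%N]card_ord max_card.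
case=> fJ sJ zp zJ zB; have [g fE] := hs f (mem_head _ _).
have [w [wp wJ wB]] := koszul_lift hJ fE fJ zp zJ zB.
rewrite addnS -addSn; apply: IH sJ wp wJ wB; first exact: is_ideal_add.
by move=> h hh; apply: hs; rewrite inE hh orbT.
Qed.

(* The wedge of the [e_i - e_(nx i)], [i] in [l]. *)
Definition wedge_diffs (nx : 'I_n -> 'I_n) (l : seq 'I_n) : {set 'I_n} -> R :=
  foldr (fun i c A => kwedge i c A - kwedge (nx i) c A) (fun A => (A == set0)%:R) l.

(** Setting every [x_i] to 1 dehomogenizes the cycle: each factor [e_i - e_(nx i)] has differential
    [1 - 1 = 0]. The monomial coefficients return in [koszul_cycle_plp]. *)
Lemma kdiff_wedge_diffs nx l A : kdiff (fun=> 1) (wedge_diffs nx l) A = 0.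
Proof.
elim: l A => [|i l IH] A /=.
  apply: big1 => k _; case: eqP => [/setP/(_ k)|]; last by rewrite mulr0.
  by rewrite !inE eqxx.
rewrite kdiffB; have kw k : kdiff (fun=> 1) (kwedge k (wedge_diffs nx l)) A =
    wedge_diffs nx l A.
  have := kdiff_wedge (fun=> 1) k (wedge_diffs nx l) A.
  rewrite mul1r {2}/kwedge IH mulr0 => <-.
  by case: ifP; rewrite addr0.
by rewrite !kw subrr.
Qed.

Lemma chain_deg_wedge_diffs nx l : chain_deg (size l) (wedge_diffs nx l).
Proof.
elim: l => [|i l IH] A /=.
  by case: (eqVneq A set0) => [->|_]; rewrite ?cards0 // mulr0n eqxx.
have [e|/(chain_deg_wedge (k := i) IH) -> //] := eqVneq (kwedge i (wedge_diffs nx l) A) 0.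
by rewrite e sub0r oppr_eq0 => /(chain_deg_wedge IH).
Qed.

End Koszul.

(** * Exchange in the base of a PLP-polymatroidal ideal *)

Section PLPBase.
Variables (n d : nat) (b alpha beta : 'X_{1..n}).
Hypothesis hplp : plp_type d 0%MM b alpha beta.
Implicit Types (u v w : 'X_{1..n}) (i j k : 'I_n).
Local Notation B := (plp_base 0%MM b alpha beta).

Lemma psumD u v i : psum (u + v)%MM i = psum u i + psum v i.
Proof. by rewrite -big_split; apply: eq_bigr => k _; rewrite mnmDE. Qed.

Lemma psum1 i j : psum U_(i)%MM j = (i <= j).
Proof.
rewrite /psum; case: leqP => ij.
  by rewrite (bigD1 i) //= mnm1E eqxx big1 // => k /andP[_ /negbTE ki]; rewrite mnm1E eq_sym ki.
by rewrite big1 // => k kj; rewrite mnm1E; case: eqP => // e; move: kj; rewrite -e leqNgt ij.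
Qed.

Lemma psum_last u i : i.+1 = n -> psum u i = mdeg u.
Proof.
move=> hi; rewrite mdegE; apply: eq_bigl => k.
by rewrite -ltnS hi ltn_ord.
Qed.

Lemma eq_psum u v i : (forall k, k <= i -> u k = v k) -> psum u i = psum v i.
Proof. by move=> e; apply: eq_bigr => k /e. Qed.

Lemma psum_zeros u i j : i <= j -> (forall k, i < k <= j -> u k = 0) ->
  psum u j = psum u i.
Proof.
move=> ij u0; rewrite /psum (bigID (fun k : 'I_n => k <= i)) /= [X in _ + X]big1 ?addn0.
  by apply: eq_bigl => k; case: (leqP k i) => ki; rewrite ?andbF // (leq_trans ki ij).
by move=> k /andP[kj]; rewrite -ltnNge => ik; apply: u0; rewrite ik.
Qed.

Lemma plp_base_mdeg u : B u -> mdeg u = d.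
Proof.
move=> hu; have n0 := plp_n_gt0 hplp.
have hl : n.-1 < n by rewrite prednK.
have e : (Ordinal hl).+1 = n by rewrite /= prednK.
have [_] := hu (Ordinal hl); rewrite (psum_last _ e).
by rewrite (plp_alpha_last hplp e) (plp_beta_last hplp e) -eqn_leq => /eqP.
Qed.

Lemma plp_beta_le i : beta i <= d.
Proof.
have n0 := plp_n_gt0 hplp; have hl : n.-1 < n by rewrite prednK.
have e : (Ordinal hl).+1 = n by rewrite /= prednK.
by rewrite -(plp_beta_last hplp e) (plp_beta_homo hplp) //= -ltnS prednK.
Qed.

(** The value [i] is a default for when [u] has no support beyond [i]; [next_suppP] excludes this
    where [psum u i < beta i]. *)
Definition next_supp u i : 'I_n :=
  odflt i [pick j : 'I_n | [&& i < j, 0 < u j & [forall k : 'I_n, (i < k < j) ==> (u k == 0)]]].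

(** As [psum u i < beta i <= d] and [u] has degree [d], some coordinate after [i] is positive. *)
Lemma next_suppP u i : B u -> psum u i < beta i ->
  [/\ i < next_supp u i, 0 < u (next_supp u i)
    & forall k, i < k < next_supp u i -> u k = 0].
Proof.
move=> hu hi; rewrite /next_supp; case: pickP => /= [j /and3P[ij uj /forallP u0]|no].
  by split=> // k hk; apply/eqP; move: (u0 k); rewrite hk.
have [j0 hj0] : exists j : 'I_n, (i < j) && (0 < u j).
  apply/existsP; apply: contraLR (leq_trans hi (plp_beta_le i)).
  move=> /existsPn h; rewrite -leqNgt -(plp_base_mdeg hu) mdegE.
  rewrite (bigID (fun k : 'I_n => k <= i)) /= [X in _ + X]big1 ?addn0 //.
  by move=> k; rewrite -ltnNge => ik; have := h k; rewrite ik /=; case: (u k).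
case: (@arg_minnP _ j0 (fun j => (i < j) && (0 < u j)) (fun j : 'I_n => j : nat) hj0) => j /andP[ij uj] jmin.
have := no j; rewrite ij uj /= => /forallP[] k; apply/implyP => /andP[ik kj].
apply: contraTT kj => uk; rewrite -leqNgt; apply: jmin; rewrite ik lt0n //.
Qed.

Lemma next_supp_uniq u i j : B u -> psum u i < beta i -> i < j -> 0 < u j ->
  (forall k, i < k < j -> u k = 0) -> next_supp u i = j.
Proof.
move=> hu hi ij uj u0; have [h1 h2 h3] := next_suppP hu hi.
apply/val_inj => /=; case: (ltngtP (next_supp u i) j) => // h.
  by have := u0 (next_supp u i); rewrite h1 h => /(_ isT) e; rewrite e in h2.
by have := h3 j; rewrite ij h => /(_ isT) e; rewrite e in uj.
Qed.

(** One unit moves from [j] back to [i]. Only the partial sums at [i <= k < j] grow, each by one;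
    there [psum u k = psum u i], as [u] vanishes strictly in between, and
    [psum u i < beta i <= beta k] leaves room. Writing the move as an equation of sums avoids
    truncated subtraction. *)
Lemma plp_base_shift u v i j : B u -> (v + U_(j) = u + U_(i))%MM -> i < j ->
  (forall k, i < k < j -> u k = 0) -> u i < b i -> psum u i < beta i -> B v.
Proof.
move=> hu e ij u0 ui pi k; have [/andP[_ uk] /andP[ak bk]] := hu k.
have ek : v k + (j == k) = u k + (i == k).
  by have := congr1 (fun w : 'X_{1..n} => w k) e; rewrite /= !mnmDE !mnm1E.
have pk : psum v k + (j <= k) = psum u k + (i <= k) by rewrite -!psum1 -!psumD e.
split.
  rewrite mnm0E /=; case: (eqVneq i k) ek => [<-|_] ek; last lia.
  have ji : (j == i) = false by apply/eqP => ji; rewrite ji ltnn in ij.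
  by move: ek; rewrite ji /= addn0 addn1 => ->.
have : i <= k < j -> psum u k < beta k.
  move=> /andP[ik kj]; rewrite (psum_zeros (i := i)) //.
    exact: leq_trans pi (plp_beta_homo hplp ik).
  by move=> l /andP[il lk]; apply: u0; rewrite il (leq_ltn_trans lk kj).
lia.
Qed.

(* Since the lower bound on [u] is [0], any later nonzero coordinate may be lowered. *)
Lemma plp_base_raise u i : B u -> u i < b i -> psum u i < beta i ->
  exists v, [/\ B v, v i = (u i).+1, forall k, k < i -> v k = u k
             & forall k, i < k -> v k <= u k].
Proof.
move=> hu ui pi; have [ij uj u0] := next_suppP hu pi.
set j := next_supp u i in ij uj u0.
have le : (U_(j) <= u + U_(i))%MM by rewrite lep1mP mnmDE; lia.
exists (u + U_(i) - U_(j))%MM; split.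
- by apply: plp_base_shift hu (submK le) ij u0 ui pi.
- by rewrite mnmBE mnmDE !mnm1E eqxx; case: eqP => [ji|_]; [move: ij; rewrite ji; lia|lia].
- move=> k ki; rewrite mnmBE mnmDE !mnm1E.
  case: eqP => [e|_]; first by move: ki; rewrite e; lia.
  case: eqP => [e|_]; last lia.
  by move: ij; rewrite e; lia.
move=> k ki; rewrite mnmBE mnmDE !mnm1E.
by case: eqP => [e|_]; [move: ki; rewrite e|]; lia.
Qed.

(** The vector [w] certifies the room: it agrees with [u] before [i], so as long as [u i < w i] both
    upper bounds at [i] are strict for [u]. Then [plp_base_raise] is repeated until [t] is
    reached. *)
Lemma plp_base_raise_to u w i t : B u -> B w -> (forall k, k < i -> u k = w k) ->
  u i <= t <= w i ->
  exists v, [/\ B v, v i = t, forall k, k < i -> v k = u k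
             & forall k, i < k -> v k <= u k].
Proof.
move=> hu hw; have [m] := ubnP (t - u i); elim: m u hu => // m IH u hu hm e /andP[ut tw].
have [ute|ne] := eqVneq (u i) t; first by exists u; split.
have lt : u i < t by rewrite ltn_neqAle ne.
have [/andP[_ wb] /andP[_ wbeta]] := hw i.
have psplit x : psum x i = \sum_(k < n | k < i) x k + x i.
  rewrite /psum (bigD1 i) //= addnC; congr (_ + _); apply: eq_bigl => k.
  by rewrite ltn_neqAle andbC.
have pu : psum u i < beta i.
  apply: leq_trans wbeta; rewrite !psplit (eq_bigr w) => [|k /e //].
  by rewrite ltn_add2l (leq_trans lt tw).
have ub : u i < b i by lia.
have [v [hv vi vlt vgt]] := plp_base_raise hu ub pu.
have [|||v' [hv' v'i v'lt v'gt]] := IH v hv.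
- by rewrite vi; lia.
- by move=> k ki; rewrite vlt // e.
- by rewrite vi lt.
exists v'; split=> //.
  by move=> k ki; rewrite v'lt // vlt.
by move=> k ki; apply: leq_trans (v'gt k ki) (vgt k ki).
Qed.

Definition plp_set u : {set 'I_n} :=
  [set i : 'I_n | [&& i.+1 < n, u i < b i & psum u i < beta i]].

End PLPBase.

(** * The lower bound *)

Lemma bounded_nat_max (P : nat -> Prop) (N : nat) :
  (exists k, P k) -> (forall k, P k -> k <= N) -> exists M, is_max P M.
Proof.
elim: N => [|N IH] ex hN.
  have [k hk] := ex; have k0 := hN k hk; exists 0; split=> //.
  by move: k0 hk; rewrite leqn0 => /eqP->.
have [hP|nP] := classic (P N.+1); first by exists N.+1; split.
apply: IH => // k hk; have := hN k hk; rewrite leq_eqVlt => /predU1P[e|//].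
by case: nP; rewrite -e.
Qed.

Section DepthLowerBound.
Local Open Scope ring_scope.
Variables (K : fieldType) (n d : nat) (b alpha beta : 'X_{1..n}).
Hypothesis hplp : plp_type d 0%MM b alpha beta.
Variables (M r : nat).
Hypothesis leN : forall u, plp_base 0%MM b alpha beta u -> (plp_N b beta u <= M)%N.
Hypothesis hr : (r + M < n)%N.
Implicit Types (u v w : 'X_{1..n}) (i j k : 'I_n) (F : {set 'I_n}).
Local Notation B := (plp_base 0%MM b alpha beta).
Local Notation S := {mpoly K[n]}.

Definition prefix_set u (m : nat) : {set 'I_n} := [set i in plp_set b beta u | (i < m)%N].

(* The monomials of the ideal obtained from [I] by dividing by [x_i^(u i)] for
   all [i < m] and killing [x_i] for the [i] in [prefix_set u m]. *)
Definition prefix_up u (m : nat) v : Prop :=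
  (exists2 i, i \in prefix_set u m & (0 < v i)%N) \/
  exists w, [/\ B w, forall i, (i < m)%N -> w i = u i
              & forall i, (m <= i)%N -> (w i <= v i)%N].

Lemma card_prefix_set u m : B u -> (#|prefix_set u m| <= M)%N.
Proof.
move=> hu; apply: leq_trans (leN hu); apply: subset_leq_card.
by apply/subsetP => i; rewrite inE => /andP[].
Qed.

(** * Passing from one prefix to the next by means of a single variable *)

Section Step.
Variables (i : 'I_n) (u : 'X_{1..n}).
Hypothesis hu : B u.
Let F := prefix_set u i.

(** The exponents in the colon of [prefix_up u i] by [x_i^t], as [step_up0] and [step_up_colon]
    show. *)
Definition step_up (t : nat) v : Prop :=
  (exists2 k, k \in F & (0 < v k)%N) \/
  exists w, [/\ B w, forall k, (k < i)%N -> w k = u k, (w i <= v i + t)%N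
              & forall k, (i < k)%N -> (w k <= v k)%N].

Lemma up_closed_step t : up_closed (step_up t).
Proof.
move=> v j [[k kF vk]|[w [hw wu wi wv]]]; [left|right].
  by exists k; rewrite // mnmDE ltn_addr.
exists w; split=> // [|k /wv]; rewrite mnmDE; lia.
Qed.

Lemma step_up0 v : step_up 0 v <-> prefix_up u i v.
Proof.
split=> -[h|[w [hw wu]]]; [by left| |by left|].
  move=> wi wv; right; exists w; split=> // k; rewrite leq_eqVlt => /predU1P[e|/wv//].
  by rewrite -(val_inj e) -(addn0 (v i)).
by move=> wv; right; exists w; split=> // [|k /ltnW /wv //]; rewrite addn0 wv.
Qed.

Lemma step_up_colon t (f : S) :
  ideal_colon (mon_ideal (step_up t)) 'X_i f <-> mon_ideal (step_up t.+1) f.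
Proof.
rewrite mon_ideal_colon; apply: eq_mon_ideal => v.
have vk k : (k != i) -> (v + U_(i))%MM k = v k.
  by move=> ki; rewrite mnmDE mnm1E eq_sym (negbTE ki) addn0.
have vi : (v + U_(i))%MM i = (v i).+1 by rewrite mnmDE mnm1E eqxx addn1.
split=> -[[k kF hk]|[w [hw wu wi wv]]].
- left; exists k => //; move: kF hk; rewrite !inE => /andP[_ ki].
  by rewrite vk //; apply: contraTneq ki => ->; rewrite ltnn.
- right; exists w; split=> // [|k ki]; first by rewrite addnS -addSn -vi.
  by rewrite -vk ?wv //; apply: contraTneq ki => ->; rewrite ltnn.
- left; exists k => //; rewrite mnmDE; lia.
- right; exists w; split=> // [|k ki]; first by rewrite vi addSn -addnS.
  by apply: leq_trans (wv k ki) _; rewrite mnmDE leq_addr.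
Qed.

(** Whether [k < i] lies in [plp_set] depends only on coordinates up to [k], where [w] agrees with
    [u]; only the index [i] can be new. *)
Lemma prefix_set_next w : (forall k, (k < i)%N -> w k = u k) ->
  prefix_set w i.+1 = if i \in plp_set b beta w then i |: F else F.
Proof.
move=> wu; have e k : (k < i)%N -> (k \in plp_set b beta w) = (k \in plp_set b beta u).
  move=> ki; rewrite !inE wu // (@eq_psum _ w u) // => l lk.
  exact/wu/(leq_ltn_trans lk ki).
apply/setP => k; rewrite [LHS]inE ltnS leq_eqVlt val_eqE.
case: (eqVneq k i) => [->|ki].
  rewrite andbT; case: ifP => [iw|_]; first by rewrite !inE eqxx.
  by rewrite [RHS]inE ltnn andbF.
have -> : (k \in (if i \in plp_set b beta w then i |: F else F)) = (k \in F).
  by case: ifP => _ //; rewrite in_setU1 (negbTE ki).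
by rewrite [RHS]inE; case: ltnP => [/e->|]; rewrite ?andbF.
Qed.

Lemma prefix_up_next w v : (forall k, (k < i)%N -> w k = u k) ->
  (exists w', [/\ B w', forall k, (k < i.+1)%N -> w' k = w k
               & forall k, (i.+1 <= k)%N -> (w' k <= v k)%N]) <->
  (exists w', [/\ B w', forall k, (k < i)%N -> w' k = u k, w' i = w i
               & forall k, (i < k)%N -> (w' k <= v k)%N]).
Proof.
move=> wu; split=> -[w' [hw' w'w]].
  move=> wv; exists w'; split=> // [k ki|]; last exact: w'w.
  by rewrite w'w ?wu // ltnW.
move=> w'i wv; exists w'; split=> // k; rewrite ltnS leq_eqVlt.
by case/predU1P => [/val_inj->//|ki]; rewrite w'w ?wu.
Qed.

(** Let [T] be the largest [i]-th coordinate among members of [B] that agree with [u] before [i].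
    Going down from [t = T] to [t = 0], [weakly_regular_colon] reduces the ideal of [step_up t] to
    its colon by [x_i], which is that of [step_up t.+1], and to its sum with [x_i], which is given
    by some [prefix_up w i.+1] or is generated by variables. *)
Lemma weakly_regular_step :
  (forall w, B w -> weakly_regular (mon_ideal (prefix_up w i.+1)) (esym_seq K n r)) ->
  weakly_regular (mon_ideal (prefix_up u i)) (esym_seq K n r).
Proof.
move=> IH.
have [T [[w1 [hw1 w1u] w1i] Tmax]] : exists T, is_max (fun T =>
    exists2 w, B w /\ (forall k, (k < i)%N -> w k = u k) & w i = T) T.
  apply: (@bounded_nat_max _ (b i)); first by exists (u i), u.
  by move=> _ [w [hw _] <-]; have [/andP[_ wb] _] := hw i.
have raise t w v : (t <= T)%N -> B w -> (forall k, (k < i)%N -> w k = u k) ->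
    (w i <= t)%N -> (forall k, (i < k)%N -> (w k <= v k)%N) ->
    exists w', [/\ B w', forall k, (k < i)%N -> w' k = u k, w' i = t
                 & forall k, (i < k)%N -> (w' k <= v k)%N].
  move=> tT hw wu wi wv; have ww1 k : (k < i)%N -> w k = w1 k.
    by move=> ki; rewrite wu ?w1u.
  have wiT : (w i <= t <= w1 i)%N by rewrite w1i wi.
  have [w' [hw' w'i w'lt w'gt]] := plp_base_raise_to hplp hw hw1 ww1 wiT.
  exists w'; split=> // k ki; first by rewrite w'lt ?wu.
  exact: leq_trans (w'gt k ki) (wv k ki).
(* At the maximum the index [i] is not counted, since [plp_base_raise] would otherwise exceed [T].
   So no new variable is killed at [t = T]. *)
have iw1 : i \notin plp_set b beta w1.
  apply/negP; rewrite inE => /and3P[_ w1b w1beta].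
  have [w [hw wi wlt _]] := plp_base_raise hplp hw1 w1b w1beta.
  have: ((w1 i).+1 <= T)%N.
    by apply: Tmax; exists w => //; split=> // k ki; rewrite wlt ?w1u.
  by rewrite w1i ltnn.
suff: forall t, (t <= T)%N -> weakly_regular (mon_ideal (step_up t)) (esym_seq K n r).
  by move=> /(_ 0 isT); apply: eq_weakly_regular; apply: eq_mon_ideal => v; apply: step_up0.
move=> t tT; rewrite -(subKn tT); elim: (T - t)%N (leq_subr t T) => {t tT} [|t IHt] tT.
  rewrite subn0; apply: eq_weakly_regular (IH w1 hw1); apply: eq_mon_ideal => v.
  rewrite /prefix_up /step_up prefix_up_next // (prefix_set_next w1u) (negbTE iw1).
  split=> -[h|[w [hw wu wi wv]]]; [by left| |by left|].
    by right; exists w; split=> //; rewrite wi w1i leq_addl.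
  right; have wiT : (w i <= T)%N by apply: Tmax; exists w.
  by rewrite w1i; apply: raise wv.
have tT' : (T - t.+1 < T)%N by lia.
set t' := (T - t.+1)%N in tT' *.
apply: (@weakly_regular_colon _ _ 'X_i); first exact/is_ideal_mon/up_closed_step.
  apply: eq_weakly_regular (IHt (ltnW tT)) => f.
  by rewrite step_up_colon subnSK.
have addE f : ideal_add (mon_ideal (step_up t')) 'X_i f <->
    mon_ideal (fun v => step_up t' v \/ (0 < v i)%N) f.
  exact/mon_ideal_add/up_closed_step.
(* Either some [w] attains [t'] at [i], and the sum with [x_i] comes from [prefix_up w i.+1]; or
   none does, and by [raise] none lies below [t'] either, so only the variables in [i |: F]
   remain. *)
have [[w [hw wu wi]]|no] := classic (exists w, [/\ B w, forall k, (k < i)%N -> w k = u k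
    & w i = t']).
  (* The vector [w1] agrees with [w] before [i] and is larger at [i], so both bounds at [i] are
     strict for [w]. The index is not the last one, where both partial sums equal [d]. *)
  have iw : i \in plp_set b beta w.
    have [/andP[_ w1b] /andP[_ w1beta]] := hw1 i.
    have lt : (psum w i < psum w1 i)%N.
      rewrite /psum (bigD1 i) //= [X in (_ < X)%N](bigD1 i) //= w1i wi.
      rewrite (eq_bigr w1) ?ltn_add2r // => k /andP[ki ne].
      by rewrite wu ?w1u // ltn_neqAle ne.
    rewrite inE (leq_trans _ w1b) ?(leq_trans lt w1beta) ?wi ?w1i // !andbT.
    rewrite ltn_neqAle ltn_ord andbT; apply/eqP => il.
    move: lt; rewrite !psum_last //.
    by rewrite (plp_base_mdeg hplp hw) (plp_base_mdeg hplp hw1) ltnn.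
  apply: eq_weakly_regular (IH w hw) => f; rewrite addE; apply: eq_mon_ideal => v.
  rewrite /prefix_up prefix_up_next // (prefix_set_next wu) iw.
  split.
    case=> [[k /setU1P[->|kF] vk]|[w' [hw' w'u w'i w'v]]]; [by right|by left; left; exists k|].
    by left; right; exists w'; split=> //; rewrite w'i wi leq_addl.
  case=> [[[k kF vk]|[w' [hw' w'u w'i w'v]]]|vi].
  - by left; exists k; rewrite // in_setU1 kF orbT.
  - have [vi|vi] := posnP (v i); last by left; exists i; rewrite // in_setU1 eqxx.
    right; rewrite wi; apply: (raise _ w') => //; first exact: ltnW.
    by rewrite vi in w'i.
  - by left; exists i; rewrite // in_setU1 eqxx.
(* At most [M] variables were killed before and [x_i] is one more, so [r + M < n] leaves at least
   [r] of them. *)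
have cF : (r <= #|~: (i |: F)|)%N.
  have := cardsC (i |: F); rewrite card_ord cardsU1.
  move: (card_prefix_set i hu); rewrite -/F; move: #|F| #|~: _| => x y.
  by move: hr; case: (_ \notin _) => /=; lia.
apply: eq_weakly_regular (weakly_regular_esym K cF) => f.
rewrite addE; apply: eq_mon_ideal => v; split.
  case=> k /setU1P[->|kF] vk; [by right|by left; left; exists k].
case=> [[[k kF vk]|[w' [hw' w'u w'i w'v]]]|vi].
- by exists k; rewrite // in_setU1 kF orbT.
- have [vi|vi] := posnP (v i); last by exists i; rewrite // in_setU1 eqxx.
  rewrite vi in w'i; have [w [hw wu wi _]] := raise t' w' v (ltnW tT') hw' w'u w'i w'v.
  by case: no; exists w.
- by exists i; rewrite // in_setU1 eqxx.
Qed.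

End Step.

(** Induction on the number [m] of coordinates not yet fixed. When all are fixed the ideal is the
    unit ideal; when none is, it is the PLP-polymatroidal ideal, whatever [u] is. *)
Lemma weakly_regular_plp :
  weakly_regular (mon_ideal (fun v => exists2 u, B u & (u <= v)%MM)) (esym_seq K n r).
Proof.
have H m u : (m <= n)%N -> B u ->
    weakly_regular (mon_ideal (prefix_up u (n - m))) (esym_seq K n r).
  elim: m u => [|m IH] u hm hu.
    apply: weakly_regular_mon_full => v; right; exists u; split=> // i.
    by rewrite subn0 leqNgt ltn_ord.
  have hlt : (n - m.+1 < n)%N by lia.
  apply: (@weakly_regular_step (Ordinal hlt)) => // w hw /=.
  by rewrite subnSK //; apply: IH => //; apply: ltnW.
have [u hu] := plp_base_nonempty hplp; have := H n u (leqnn n) hu.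
apply: eq_weakly_regular; apply: eq_mon_ideal => v; rewrite subnn; split.
  case=> [[i]|[w [hw _ wv]]]; first by rewrite inE ltn0 andbF.
  by exists w => //; apply/mnm_lepP => i; apply: wv.
by case=> w hw /mnm_lepP wv; right; exists w; split.
Qed.

End DepthLowerBound.

(** * The upper bound *)

Lemma pairwise_ltn_enum n (D : {set 'I_n}) :
  pairwise (fun i j : 'I_n => i < j) (enum D).
Proof.
rewrite -sorted_pairwise; last by move=> x y z; apply: ltn_trans.
rewrite /enum_mem; apply: sorted_filter; first by move=> x y z; apply: ltn_trans.
by have := iota_ltn_sorted 0 n; rewrite -val_enum_ord sorted_map enumT.
Qed.

Section DepthUpperBound.
Local Open Scope ring_scope.
Variables (n d : nat) (b alpha beta : 'X_{1..n}).
Hypothesis hplp : plp_type d 0%MM b alpha beta.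
Variable u : 'X_{1..n}.
Hypothesis hu : plp_base 0%MM b alpha beta u.
Implicit Types (v w : 'X_{1..n}) (i j k : 'I_n) (A : {set 'I_n}) (l : seq 'I_n).
Local Notation B := (plp_base 0%MM b alpha beta).
Local Notation next := (next_supp u).
Local Notation ltO := (fun i j : 'I_n => (i < j)%N).

(* [v + 1_A] is the common multidegree [u + 1_l] of all terms of the cycle. *)
Lemma wedge_diffs_support (R : comNzRingType) l A :
  {subset l <= plp_set b beta u} -> pairwise ltO l ->
  wedge_diffs R next l A != 0 ->
  exists v, [/\ B v, forall k, (v k + (k \in A) = u k + (k \in l))%N,
    forall k, k \in l -> k \notin A -> next k \in A
    & forall k, k \in A -> exists2 i, i \in l & (i <= k)%N].
Proof.
elim: l A => [|i l IH] A hl /=.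
  move=> _; case: (eqVneq A set0) => [->|_]; last by rewrite mulr0n eqxx.
  by move=> _; exists u; split=> // k; rewrite !inE.
case/andP => /allP il pl hA.
have hl' : {subset l <= plp_set b beta u}.
  by move=> k kl; apply: hl; rewrite inE kl orbT.
have := hl i (mem_head _ _); rewrite inE => /and3P[_ ui pi].
have [ij uj u0] := next_suppP hplp hu pi.
have iNl : i \notin l by apply/negP => /il; rewrite ltnn.
(* A nonzero coordinate at [A] comes from [e_i] or from [e_(next i)]. In the first case the vector
   found for [A :\ i] still serves; in the second, one unit has to move from [next i] to [i]. *)
have [[iA cA]|{}hA] : (i \in A /\ wedge_diffs R next l (A :\ i) != 0) \/
    (next i \in A /\ wedge_diffs R next l (A :\ next i) != 0).
- have [e|/kwedge_neq0] := eqVneq (kwedge i (wedge_diffs R next l) A) 0; last by left.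
  by right; apply: kwedge_neq0; move: hA; rewrite e sub0r oppr_eq0.
- have [v [hv vA vl vge]] := IH _ hl' pl cA; exists v; split=> //.
  + move=> k; have := vA k; rewrite in_setD1 inE.
    by case: (eqVneq k i) => [->|_] //=; rewrite iA (negbTE iNl) addn0 => ->; lia.
  + move=> k; rewrite inE; case: (eqVneq k i) => [->|_ /= kl kA]; first by rewrite iA.
    by have := vl k kl; rewrite !in_setD1 (negbTE kA) andbF => /(_ isT) /andP[].
  + move=> k kA; case: (eqVneq k i) => [->|ki]; first by exists i; rewrite ?mem_head.
    have [|i' i'l ik] := vge k; first by rewrite in_setD1 ki.
    by exists i'; rewrite // inE i'l orbT.
case: hA => jA cA; have [v [hv vA vl vge]] := IH _ hl' pl cA.
set j := next i in ij uj u0 jA cA vA vl vge *; set A' := A :\ j in vA vl vge.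
have jA' : j \notin A' by rewrite in_setD1 eqxx.
have leA' k : (k <= i)%N -> k \notin A' /\ k \notin l.
  move=> ki; split; apply/negP; last by move/il; lia.
  by move/vge => [i' /il h1 h2]; lia.
have v_le k : (k <= i)%N -> v k = u k.
  by move=> /leA' [kA' kl]; have := vA k; rewrite (negbTE kA') (negbTE kl) !addn0.
(* An index [k] of [l] between [i] and [j] has [next k = j]; were it missing from [A'], then [j]
   would lie in [A']. *)
have v0 k : (i < k < j)%N -> v k = 0%N.
  move=> hk; have := vA k; rewrite (u0 k hk) add0n.
  have [kA'|kA'] := boolP (k \in A'); first by case: (k \in l); lia.
  rewrite addn0 => ->; have [kl|//] := boolP (k \in l).
  have := hl' k kl; rewrite inE => /and3P[_ _ pk]; case/andP: hk => ik kj.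
  have := vl k kl kA'; rewrite (next_supp_uniq hplp hu pk kj uj) ?(negbTE jA') //.
  by move=> k' /andP[h1 h2]; apply: u0; rewrite h2 (ltn_trans ik h1).
have vj : (0 < v j)%N by have := vA j; rewrite (negbTE jA'); lia.
have le : (U_(j) <= v + U_(i))%MM by rewrite lep1mP mnmDE; lia.
exists (v + U_(i) - U_(j))%MM; split.
- apply: (plp_base_shift hplp hv (submK le) ij v0); first by rewrite v_le.
  by rewrite (eq_psum v_le).
- move=> k; rewrite mnmBE mnmDE !mnm1E inE; have := vA k; rewrite in_setD1.
  case: (eqVneq k j) => [->|kj] /=.
    have -> : (i == j) = false by apply/eqP => e; rewrite -e ltnn in ij.
    by rewrite jA; case: eqP => [e|_] /=; [rewrite -e ltnn in ij|lia].
  case: (eqVneq k i) => [->|_] /=; rewrite ?addn0 subn0 //.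
  by rewrite (negbTE iNl) addn0 addnAC => ->.
- move=> k; rewrite inE => /orP[/eqP->//|kl kA].
  by have := vl k kl; rewrite !in_setD1 (negbTE kA) andbF => /(_ isT) /andP[].
move=> k kA; case: (eqVneq k j) => [->|kj]; first by exists i; rewrite ?mem_head // ltnW.
have [|i' i'l ik] := vge k; first by rewrite in_setD1 kj.
by exists i'; rewrite // inE i'l orbT.
Qed.

(** Only the product of the [e_i] reaches the wedge on all of [l]. A term using [e_(next i)] for the
    first index [i] would need [i] from the later factors, whose indices all exceed [i]. *)
Lemma wedge_diffs_top (R : comNzRingType) l :
  {subset l <= plp_set b beta u} -> pairwise ltO l ->
  exists e : nat, wedge_diffs R next l [set k in l] = (-1) ^+ e.
Proof.
elim: l => [|i l IH] hl /=.
  by move=> _; exists 0%N; rewrite set_nil eqxx.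
case/andP => /allP il pl.
have hl' : {subset l <= plp_set b beta u}.
  by move=> k kl; apply: hl; rewrite inE kl orbT.
have := hl i (mem_head _ _); rewrite inE => /and3P[_ ui pi].
have [ij uj u0] := next_suppP hplp hu pi.
have iNl : i \notin l by apply/negP => /il; rewrite ltnn.
have [e he] := IH hl' pl.
have -> : kwedge (next i) (wedge_diffs R next l) [set k in i :: l] = 0.
  apply/eqP; apply: contraT => /kwedge_neq0 [_ /(wedge_diffs_support hl' pl)].
  case=> v [_ _ _ /(_ i)]; rewrite in_setD1 !inE eqxx /= andbT.
  case; first by apply/eqP => e'; rewrite -e' ltnn in ij.
  by move=> i' /il h1 h2; lia.
rewrite subr0 /kwedge inE mem_head.
have -> : [set k in i :: l] :\ i = [set k in l].
  apply/setP => k; rewrite !inE; case: eqP => [->|] //=.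
  by rewrite (negbTE iNl).
by rewrite he /ksign -exprD; eexists.
Qed.

Variable K : fieldType.
Local Notation S := {mpoly K[n]}.
Local Notation I := (mon_ideal (K := K) (fun v => exists2 w, B w & (w <= v)%MM)).

(** The chain [z] is a preimage of the cycle over [I] under the connecting map of
    [0 -> I -> S -> S/I -> 0]: its differential is that cycle. It arises from [e_q] wedged with the
    dehomogenized cycle, where [u q > 0], by restoring monomials. *)
Lemma koszul_cycle_plp : exists z : {set 'I_n} -> S,
  [/\ chain_deg (plp_N b beta u).+1 z, chain_cycle (fun i => 'X_i) I z
    & ~ chain_boundary (fun i => 'X_i) I z].
Proof.
pose X i : S := 'X_i.
pose F := plp_set b beta u; pose l := enum F.
have hl : {subset l <= plp_set b beta u} by move=> k; rewrite mem_enum.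
have pl : pairwise ltO l := pairwise_ltn_enum F.
have lF : [set k in l] = F by apply/setP => k; rewrite inE mem_enum.
have [q uq] : exists q, (0 < u q)%N.
  apply/existsP; apply: contraLR (plp_d_gt0 hplp) => /existsPn h.
  rewrite -(plp_base_mdeg hplp hu) mdegE big1 // => k _.
  by have := h k; case: (u k).
(* The multidegree shared by all terms of [z]. *)
pose c := (u + mesym1 F)%MM.
have m1E A k : mesym1 A k = (k \in A) by rewrite mnmE.
have cE k : c k = (u k + (k \in F))%N by rewrite mnmDE m1E.
pose phi := wedge_diffs S next l; pose psi := kwedge q phi.
have dpsi A : kdiff (fun=> 1) psi A = phi A.
  have := kdiff_wedge (fun=> 1) q phi A.
  rewrite mul1r {2}/kwedge kdiff_wedge_diffs mulr0 => <-.
  by case: ifP; rewrite addr0.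
have phic A : phi A != 0 -> exists2 v, B v & forall k, (v k + (k \in A) = c k)%N.
  move/(wedge_diffs_support hl pl) => [v [hv vA _ _]]; exists v => // k.
  by rewrite vA cE mem_enum.
(* This makes the truncated subtraction in [z] exact; the case [k = q] uses [u q > 0]. *)
have psic A : psi A != 0 -> forall k, ((k \in A) <= c k)%N.
  move/kwedge_neq0 => [qA /phic [v _ vA]] k; have := vA k; rewrite in_setD1.
  case: (eqVneq k q) => [->|_ /= <-]; last exact: leq_addl.
  by rewrite qA cE; lia.
pose z A : S := psi A * 'X_[c - mesym1 A]; exists z.
have dz A : kdiff X z A = phi A * 'X_[c - mesym1 A].
  rewrite -dpsi mulr_suml; apply: eq_bigr => i iA; rewrite mulr1 /z /X.
  have [->|/psic hc] := eqVneq (psi (i |: A)) 0; first by rewrite !(mulr0, mul0r).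
  have -> : 'X_[c - mesym1 A] = 'X_i * 'X_[c - mesym1 (i |: A)] :> S.
    rewrite -mpolyXD; congr 'X_[_]; apply/mnmP => k.
    rewrite mnmDE mnm1E [LHS]mnmBE [X in (_ + X)%N]mnmBE !m1E in_setU1.
    have := hc k; rewrite in_setU1 eq_sym; case: (eqVneq i k) => [<-|_] //=.
    by rewrite (negbTE iA) subn0 add1n subn1 => /prednK->.
  by ring.
have hI := is_ideal_mon K (@up_closed_gen n B).
split.
- rewrite /plp_N -/(plp_set b beta u) -/F cardE -/l => A zA.
  apply: (chain_deg_wedge (@chain_deg_wedge_diffs _ S next l) (k := q)).
  by apply: contra_neq zA => h; rewrite /z /psi /phi h mul0r.
- move=> A; rewrite dz.
  have [->|/phic [v hv vA]] := eqVneq (phi A) 0; first by rewrite mul0r; apply: ideal0.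
  apply: (idealM _ hI); apply: mon_idealX; exists v => //.
  by apply/mnm_lepP => k; rewrite mnmBE m1E -vA addnK.
(* If [z] bounded modulo [I], then [z - dy] would have coefficients in [I], of degree at least [d],
   and its differential would have only terms of degree above [d]. But that differential is [dz],
   whose coefficient on [F] is [x^u] up to sign. *)
case=> y hy; pose J := mon_ideal (K := K) (fun m : 'X_{1..n} => (d < mdeg m)%N).
have hJ : is_ideal J by apply: is_ideal_mon => m i; rewrite mdegD => /ltn_addr->.
have : J (kdiff X (fun A => z A - kdiff X y A) F).
  apply: (ideal_sum _ hJ) => i _; rewrite -mulrA; apply: (idealM _ hJ).
  rewrite mulrC; apply/mon_ideal_colon => m /(hy _) [w hw /mnm_lepP wm].
  rewrite mdegD mdeg1 addn1 ltnS -(plp_base_mdeg hplp hw) !mdegE.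
  by apply: leq_sum => k _; apply: wm.
have [e he] := wedge_diffs_top S hl pl.
rewrite kdiffB kdiff_kdiff subr0 dz /phi -lF he lF.
have -> : (c - mesym1 F)%MM = u by apply/mnmP => k; rewrite mnmBE cE m1E addnK.
move/(idealM ((-1) ^+ e) hJ); rewrite mulrA -expr2 sqrr_sign mul1r => /(_ u).
by rewrite msuppX mem_head => /(_ isT); rewrite (plp_base_mdeg hplp hu) ltnn.
Qed.

Lemma weakly_regular_plp_bound (s : seq S) :
  (forall f, f \in s -> irrelevant_ideal f) -> weakly_regular I s ->
  ((plp_N b beta u).+1 + size s <= n)%N.
Proof.
move=> hs hr; have [z [zd zc zb]] := koszul_cycle_plp.
apply: (koszul_bound (is_ideal_mon K (@up_closed_gen n B)) _ hr zd zc zb).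
by move=> f /hs /irrelevantP.
Qed.

End DepthUpperBound.

(** * Minimal generators, and the depth as the common value of the two bounds *)

Theorem proposition4p3 (K : fieldType) (n d : nat)
  (b alpha beta : 'X_{1..n})
  (hplp : plp_type d 0%MM b alpha beta)
  (I : {mpoly K[n]} -> Prop)
  (hI : forall f : {mpoly K[n]}, I f <-> plp_ideal 0%MM b alpha beta f) :
  exists M : nat,
    is_max (fun k => exists2 u : 'X_{1..n}, min_mon_gen I u & plp_N b beta u = k) M
    /\ depth_quotient I (n - 1 - M).
Proof.
pose B := plp_base 0%MM b alpha beta.
pose U (v : 'X_{1..n}) := exists2 u, B u & (u <= v)%MM.
have IU f : I f <-> mon_ideal U f by rewrite hI; apply: mon_ideal_gen.
have hU : is_ideal (mon_ideal (K := K) U) := is_ideal_mon K (@up_closed_gen n B).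
have Iid : is_ideal I.
  split; first by apply/IU; exact: (ideal0 hU).
    by move=> f g /IU hf /IU hg; apply/IU; exact: (idealD hU).
  by move=> f g /IU hg; apply/IU; exact: (idealM _ hU).
(* All members of [B] have degree [d], so comparable ones are equal and each of them is a minimal
   generator. *)
have genE u : min_mon_gen I u <-> B u.
  have IX v : I 'X_[v] <-> U v.
    rewrite IU; split; last exact: mon_idealX.
    by apply; rewrite msuppX mem_head.
  have le_eq v w : B v -> B w -> (v <= w)%MM -> v = w.
    move=> hv hw le; have := mdegD (w - v)%MM v; rewrite submK //.
    rewrite (plp_base_mdeg hplp hv) (plp_base_mdeg hplp hw) -{1}[d]add0n.
    move/addIn/esym/eqP; rewrite mdeg_eq0 => /eqP e.
    by rewrite -(submK le) e add0m.
  split=> [[/IX[v hv le] umin]|hu].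
    by rewrite -(umin v) //; apply/IX; exists v => //; apply: lepm_refl.
  split; first by apply/IX; exists u => //; apply: lepm_refl.
  move=> v /IX[w hw wv] vu; have wu := le_eq w u hw hu (lepm_trans wv vu).
  by apply/mnmP => i; apply/eqP; rewrite eqn_leq (mnm_lepP vu) -wu (mnm_lepP wv).
have bound u s : B u -> (forall f, f \in s -> irrelevant_ideal f) ->
    weakly_regular I s -> ((plp_N b beta u).+1 + size s <= n)%N.
  move=> hu hs hr; apply: (weakly_regular_plp_bound hplp hu hs).
  exact: eq_weakly_regular hr.
have [M hM] : exists M, is_max
    (fun k => exists2 u : 'X_{1..n}, min_mon_gen I u & plp_N b beta u = k) M.
  apply: (@bounded_nat_max _ n).
    by have [u hu] := plp_base_nonempty hplp; exists (plp_N b beta u), u => //; apply/genE.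
  by move=> _ [u _ <-]; rewrite -[n in (_ <= n)%N]card_ord max_card.
exists M; split=> //; have [[u0 /genE hu0 Nu0] Mmax] := hM.
(* The bound for the empty sequence; it keeps [n - 1 - M] from being truncated. *)
have Mn : M < n.
  by have := bound u0 [::] hu0; rewrite Nu0 addn0; apply.
split.
  exists (esym_seq K n (n - 1 - M)); split; first by rewrite size_map size_iota.
    exact: esym_seq_irrelevant.
  apply/regular_seqE => //; split.
    apply: (@eq_weakly_regular _ (mon_ideal U)); first by move=> f; rewrite IU.
    apply: (weakly_regular_plp K hplp (M := M)); last by lia.
    by move=> u hu; apply: Mmax; exists u => //; apply/genE.
  (* Since [d > 0], both [I] and the symmetric polynomials lie in the irrelevant ideal, which does
     not contain 1. *)
  move=> h1; have : irrelevant_ideal (1 : {mpoly K[n]})%R.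
    apply: ideal_adds_min h1; [exact: is_ideal_gen| |exact: esym_seq_irrelevant].
    move=> f /IU hf; apply/irrelevant_mon => m /hf [v hv vm].
    apply: contraTneq (plp_d_gt0 hplp) => m0; rewrite -leqNgt.
    rewrite -(plp_base_mdeg hplp hv) leqn0 mdeg_eq0; apply/eqP/mnmP => i.
    by apply/eqP; rewrite mnm0E -leqn0; have := mnm_lepP vm i; rewrite m0 mnm0E.
  move/irrelevant_mon => /(_ 0%MM); rewrite msupp1 mem_head => /(_ isT).
  by rewrite eqxx.
move=> k [s [<- hs /(regular_seqE _ Iid) [hr _]]].
by have := bound u0 s hu0 hs hr; rewrite Nu0 -subnDA add1n leq_subRL.
Qed.
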